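(* Let $$R=\tfrac94-2x^2-y^2,\qquad K=2x^2+\tfrac12y^2-\tfrac18,\qquad \mu=\sqrt{2/R},\qquad \rho=e^{2u},$$ and let $\mathcal C$ be the smooth function on the state space $$\mathcal S=\{(x,y,u,\theta,v)\in\mathbb R^5:\ R(x,y)>0\}$$ defined in the context (the Frobenius curvature of the prolonged spherical Gauss--Codazzi phase system). Then $\mathcal C<0$ everywhere on $\mathcal S$ (that is, on the region $R>0$, $\rho>0$). Hence the spherical non-CMC compatibility system has no local solution: there are no nonempty open set $\Omega\subset\{(x,y)\in\mathbb R^2:R(x,y)>0\}$ and smooth functions $u:\Omega\to\mathbb R$, $Q:\Omega\to\mathbb C$ satisfying, with $z=x+iy$, $$(\partial_x^2+\partial_y^2)u+e^{2u}K=0,\qquad Q_{\bar z}=\tfrac14e^{2u},\qquad |Q|^2=\tfrac18e^{4u}R .$$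
   Context: Write $C=\cos\theta$, $S=\sin\theta$, $d=2xC-yS$, $e=2xS+yC$, and define on $\mathcal S$ $$a=\frac dR+\frac{3}{\mu R}+\frac{8x^2+2y^2}{\mu R^2}+\frac{2K\rho}{\mu},\qquad P=\frac12\Bigl(a+\mu+\frac dR\Bigr),\qquad B=2v+\frac eR .$$ For a function $F(x,y,u,\theta)$ (independent of $v$) put the total derivatives $$XF=C F_x-S F_y+P F_u+B F_\theta,\qquad YF=-S F_x-C F_y+v F_u-a F_\theta ,$$ and define $$f=YP-BP+av,\qquad g=\frac12\Bigl(B^2+a^2-Xa-Y\bigl(\tfrac eR\bigr)\Bigr).$$ Define vector fields on $\mathcal S$ by $$\mathcal X=C\partial_x-S\partial_y+P\partial_u+B\partial_\theta+f\partial_v,\qquad \mathcal Y=-S\partial_x-C\partial_y+v\partial_u-a\partial_\theta+g\partial_v ,$$ which satisfy $[\mathcal X,\mathcal Y]+B\mathcal X-a\mathcal Y=\mathcal C\,\partial_v$, where $$\mathcal C:=\mathcal X(g)-\mathcal Y(f)+Bf-ag .$$ (The system for $(u,Q)$ is the Gauss--Codazzi system, with ambient curvature normalized to $c=1$, of a surface whose mean curvature is $H=x$ and for which the trace-free shape operator satisfies $|A^\circ|^2=R$; writing $Q=e^{2u}\sqrt{R/8}\,e^{i\theta}$, it is locally equivalent to $Xu=P$, $Xθ=B$, $Yu=v$, $Y\theta=-a$ for functions $u,\theta,v$ of $(x,y)$, with $X=C\partial_x-S\partial_y$, $Y=-S\partial_x-C\partial_y$.) *)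

(* Defs.v *)
From Stdlib Require Export Reals.
From Coquelicot Require Export Coquelicot.
Open Scope R_scope.

(** A point of the state space is given by its coordinates [x y u t v], with
    [t] the angle theta.  A function independent of [v] takes only the
    arguments [x y u t]. *)

Definition Rfun (x y : R) : R := 9 / 4 - 2 * x ^ 2 - y ^ 2.
Definition Kfun (x y : R) : R := 2 * x ^ 2 + 1 / 2 * y ^ 2 - 1 / 8.
Definition mu (x y : R) : R := sqrt (2 / Rfun x y).
Definition rho (u : R) : R := exp (2 * u).

Definition state_space (x y u t v : R) : Prop := 0 < Rfun x y.

Definition coef_d (x y t : R) : R := 2 * x * cos t - y * sin t.
Definition coef_e (x y t : R) : R := 2 * x * sin t + y * cos t.

Definition coef_a (x y u t : R) : R :=
  coef_d x y t / Rfun x y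
  + 3 / (mu x y * Rfun x y)
  + (8 * x ^ 2 + 2 * y ^ 2) / (mu x y * Rfun x y ^ 2)
  + 2 * Kfun x y * rho u / mu x y.

Definition coef_P (x y u t : R) : R :=
  1 / 2 * (coef_a x y u t + mu x y + coef_d x y t / Rfun x y).

Definition coef_B (x y u t v : R) : R := 2 * v + coef_e x y t / Rfun x y.

Definition total_X (F : R -> R -> R -> R -> R) (x y u t v : R) : R :=
  cos t * Derive (fun s => F s y u t) x
  - sin t * Derive (fun s => F x s u t) y
  + coef_P x y u t * Derive (fun s => F x y s t) u
  + coef_B x y u t v * Derive (fun s => F x y u s) t.

Definition total_Y (F : R -> R -> R -> R -> R) (x y u t v : R) : R :=
  - sin t * Derive (fun s => F s y u t) x
  - cos t * Derive (fun s => F x s u t) y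
  + v * Derive (fun s => F x y s t) u
  - coef_a x y u t * Derive (fun s => F x y u s) t.

Definition coef_f (x y u t v : R) : R :=
  total_Y coef_P x y u t v
  - coef_B x y u t v * coef_P x y u t
  + coef_a x y u t * v.

Definition coef_g (x y u t v : R) : R :=
  1 / 2 * (coef_B x y u t v ^ 2 + coef_a x y u t ^ 2
           - total_X coef_a x y u t v
           - total_Y (fun x y _ t => coef_e x y t / Rfun x y) x y u t v).

Definition field_X (G : R -> R -> R -> R -> R -> R) (x y u t v : R) : R :=
  cos t * Derive (fun s => G s y u t v) x
  - sin t * Derive (fun s => G x s u t v) y
  + coef_P x y u t * Derive (fun s => G x y s t v) u
  + coef_B x y u t v * Derive (fun s => G x y u s v) t
  + coef_f x y u t v * Derive (fun s => G x y u t s) v.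

Definition field_Y (G : R -> R -> R -> R -> R -> R) (x y u t v : R) : R :=
  - sin t * Derive (fun s => G s y u t v) x
  - cos t * Derive (fun s => G x s u t v) y
  + v * Derive (fun s => G x y s t v) u
  - coef_a x y u t * Derive (fun s => G x y u s v) t
  + coef_g x y u t v * Derive (fun s => G x y u t s) v.

Definition frobenius_curvature (x y u t v : R) : R :=
  field_X coef_g x y u t v - field_Y coef_f x y u t v
  + coef_B x y u t v * coef_f x y u t v
  - coef_a x y u t * coef_g x y u t v.

(** C-infinity smoothness on a set meant to be open; the values outside of it
    are then irrelevant. *)
Definition smooth_on (Omega : R * R -> Prop) (h : R -> R -> R) : Prop :=
  forall (n : nat) (x y : R), Omega (x, y) -> ex_diff_n h n x y.

Definition Csmooth_on (Omega : R * R -> Prop) (Q : R -> R -> C) : Prop :=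
  smooth_on Omega (fun x y => Re (Q x y)) /\
  smooth_on Omega (fun x y => Im (Q x y)).

Definition laplacian (h : R -> R -> R) (x y : R) : R :=
  partial_derive 2 0 h x y + partial_derive 0 2 h x y.

Definition Cpartial_x (Q : R -> R -> C) (x y : R) : C :=
  (partial_derive 1 0 (fun x y => Re (Q x y)) x y,
   partial_derive 1 0 (fun x y => Im (Q x y)) x y).

Definition Cpartial_y (Q : R -> R -> C) (x y : R) : C :=
  (partial_derive 0 1 (fun x y => Re (Q x y)) x y,
   partial_derive 0 1 (fun x y => Im (Q x y)) x y).

Definition dbar (Q : R -> R -> C) (x y : R) : C :=
  (RtoC (1 / 2) * (Cpartial_x Q x y + Ci * Cpartial_y Q x y))%C.

Definition compatibility_system
    (Omega : R * R -> Prop) (u : R -> R -> R) (Q : R -> R -> C) : Prop :=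
  forall x y : R, Omega (x, y) ->
    laplacian u x y + exp (2 * u x y) * Kfun x y = 0 /\
    dbar Q x y = RtoC (1 / 4 * exp (2 * u x y)) /\
    Cmod (Q x y) ^ 2 = 1 / 8 * exp (4 * u x y) * Rfun x y.

(* Main.v *)
Require Import Defs.
From Stdlib Require Import Reals Lra Lia Psatz.
From Coquelicot Require Import Coquelicot.

(** With [m = mu], one has [1 / R = m^2 / 2], so every coefficient is a
    polynomial in [x, y, cos t, sin t, v, E = rho, m], subject to
    [m^2 R = 2] and [cos^2 + sin^2 = 1].  In the scaled variables
    [p = x m], [q = y m], [V = v / m], [eps = E / m^4] the curvature is [m^3]
    times a polynomial in which the radius constraint has disappeared.  It has no
    [V eps] term; its [eps^2] coefficient is minus a square times
    [1 + 4 p^2 + q^2], its [eps] coefficient is negative, and the remaining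
    quadratic polynomial in [V] is negative.

    A solution [(u, Q)] gives [c + i s = Q / |Q|] and the differential
    [c ds - s dc] of its angle, so no choice of angle is needed.  The two real
    equations in [Q_zbar] and the equation for the Laplacian of [u], together
    with closedness of this differential, yield [X u = P], [X theta = B] and
    [Y theta = - a].  Applying [[X, Y] = - B X + a Y] to [u], [theta] and
    [v = Y u] gives successively [X v = f], [Y v = g] and vanishing curvature. *)

Open Scope R_scope.

(** * Polynomial expressions and formal derivations *)

Inductive gen := gx | gy | gc | gs | gv | gE | gm.

Inductive pexp :=
| Const (k : R)
| Gen (g : gen)
| Add (F G : pexp)
| Mul (F G : pexp).

Declare Scope pexp_scope.
Delimit Scope pexp_scope with P.
Bind Scope pexp_scope with pexp.
Infix "+" := Add : pexp_scope.
Infix "*" := Mul : pexp_scope.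
Notation "F - G" := (Add F (Mul (Const (-1)) G)) : pexp_scope.

Fixpoint eval (e : gen -> R) (F : pexp) : R :=
  match F with
  | Const k => k
  | Gen g => e g
  | Add F G => eval e F + eval e G
  | Mul F G => eval e F * eval e G
  end.

(** Forward-mode differential at [e] in the direction [e']. *)
Fixpoint tangent (e e' : gen -> R) (F : pexp) : R :=
  match F with
  | Const _ => 0
  | Gen g => e' g
  | Add F G => tangent e e' F + tangent e e' G
  | Mul F G => tangent e e' F * eval e G + eval e F * tangent e e' G
  end.

(** Unlike [tangent], the result is again an expression and can be differentiated once more:
    [curvature_] applies derivations to [f_] and [g_], which already contain derivatives. *)
Fixpoint der (delta : gen -> pexp) (F : pexp) : pexp :=
  match F with
  | Const _ => Const 0
  | Gen g => delta g
  | Add F G => der delta F + der delta G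
  | Mul F G => der delta F * G + F * der delta G
  end%P.

Lemma eval_der (e : gen -> R) (delta : gen -> pexp) (F : pexp) :
  eval e (der delta F) = tangent e (fun g => eval e (delta g)) F.
Proof. induction F as [| |F IHF G IHG|F IHF G IHG]; simpl; rewrite ?IHF, ?IHG; reflexivity. Qed.

Lemma tangent_ext (e e1 e2 : gen -> R) (F : pexp) :
  (forall g, e1 g = e2 g) -> tangent e e1 F = tangent e e2 F.
Proof.
intros H; induction F as [|g|F IHF G IHG|F IHF G IHG]; simpl; rewrite ?IHF, ?IHG, ?H; reflexivity.
Qed.

Lemma tangent_add (e e1 e2 : gen -> R) (F : pexp) :
  tangent e (fun g => e1 g + e2 g) F = tangent e e1 F + tangent e e2 F.
Proof.
induction F as [|g|F IHF G IHG|F IHF G IHG]; simpl; rewrite ?IHF, ?IHG; ring.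
Qed.

Lemma tangent_scale (e e1 : gen -> R) (k : R) (F : pexp) :
  tangent e (fun g => k * e1 g) F = k * tangent e e1 F.
Proof.
induction F as [|g|F IHF G IHG|F IHF G IHG]; simpl; rewrite ?IHF, ?IHG; ring.
Qed.

Lemma is_derive_eval (path : R -> gen -> R) (e' : gen -> R) (z : R) (F : pexp) :
  (forall g, is_derive (fun s => path s g) z (e' g)) ->
  is_derive (fun s => eval (path s) F) z (tangent (path z) e' F).
Proof.
intros H; induction F as [k|g|F IHF G IHG|F IHF G IHG]; simpl.
- apply @is_derive_const.
- apply H.
- apply @is_derive_plus; assumption.
- apply (is_derive_mult _ _ _ _ _ IHF IHG); intros; apply Rmult_comm.
Qed.

(** * The phase system in polynomial form *)

Local Open Scope pexp_scope.
Definition x_ := Gen gx.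
Definition y_ := Gen gy.
Definition c_ := Gen gc.
Definition s_ := Gen gs.
Definition v_ := Gen gv.
Definition E_ := Gen gE.
Definition m_ := Gen gm.

Definition R_ := Const (9 / 4) - Const 2 * (x_ * x_) - y_ * y_.
Definition K_ := Const 2 * (x_ * x_) + Const (1 / 2) * (y_ * y_) - Const (1 / 8).
Definition dR_ := (Const 2 * (x_ * c_) - y_ * s_) * (Const (1 / 2) * (m_ * m_)).
Definition eR_ := (Const 2 * (x_ * s_) + y_ * c_) * (Const (1 / 2) * (m_ * m_)).
(** [1 / m] is encoded as [m R / 2]. *)
Definition a_ :=
  dR_ + Const (3 / 2) * m_
  + (Const 2 * (x_ * x_) + Const (1 / 2) * (y_ * y_)) * (m_ * m_ * m_)
  + K_ * E_ * m_ * R_.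
Definition P_ := Const (1 / 2) * (a_ + m_ + dR_).
Definition B_ := Const 2 * v_ + eR_.

(** [w] is the component of the vector field along [v]; it is irrelevant for
    expressions not involving [v]. *)
Definition X_images (w : pexp) (g : gen) : pexp :=
  match g with
  | gx => c_
  | gy => Const (-1) * s_
  | gc => Const (-1) * (s_ * B_)
  | gs => c_ * B_
  | gv => w
  | gE => Const 2 * (E_ * P_)
  | gm => (x_ * c_ - Const (1 / 2) * (y_ * s_)) * (m_ * m_ * m_)
  end.

(** For both fields, the images of [gc] and [gs] express that the angle changes at rate [B] along X
    and [- a] along Y; those of [gm] come from dmu = mu^3 (x dx + (y / 2) dy). *)
Definition Y_images (w : pexp) (g : gen) : pexp :=
  match g with
  | gx => Const (-1) * s_
  | gy => Const (-1) * c_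
  | gc => s_ * a_
  | gs => Const (-1) * (c_ * a_)
  | gv => w
  | gE => Const 2 * (E_ * v_)
  | gm => Const (-1) * (x_ * s_ + Const (1 / 2) * (y_ * c_)) * (m_ * m_ * m_)
  end.

Definition f_ := der (Y_images (Const 0)) P_ - B_ * P_ + a_ * v_.
Definition g_ :=
  Const (1 / 2) * (B_ * B_ + a_ * a_ - der (X_images (Const 0)) a_ - der (Y_images (Const 0)) eR_).
Definition curvature_ :=
  der (X_images f_) g_ - der (Y_images g_) f_ + B_ * f_ - a_ * g_.
Local Close Scope pexp_scope.

(** These relations hold on the state space and also along a solution, so negativity is proved once
    for both. *)
Definition on_state (e : gen -> R) : Prop :=
  0 < e gm /\ 0 < e gE /\
  e gm ^ 2 * (9 / 4 - 2 * e gx ^ 2 - e gy ^ 2) = 2 /\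
  e gc ^ 2 + e gs ^ 2 = 1.

(** * Negativity of the curvature polynomial *)

(** The part free of [V] and [eps]. Here [D = m d] and [E = m e] (not rho), so that [L = D^2 + E^2]
    on the unit circle. *)
Definition scaled_curvature_0 (p q c s : R) :=
  let D := 2 * p * c - q * s in let E := 2 * p * s + q * c in
  let L := 4 * p ^ 2 + q ^ 2 in
  - (L / 16) * (L - 2 * D) ^ 2 + L * D ^ 2 - 25 / 16 * L ^ 2 + L * (3 / 4 * D + p * c)
  - 35 / 16 * D ^ 2 - 79 / 16 * E ^ 2 - 4 * p ^ 2 - 2 * E * (p * s) + D / 2 + p * c - 43 / 16.

(** The coefficient of [eps]. Since m^2 R = 2 amounts to 9 m^2 / 4 = 2 + 2 p^2 + q^2, the factor [k]
    is 9 m^2 K. *)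
Definition scaled_curvature_1 (p q c s : R) :=
  let D := 2 * p * c - q * s in
  let L := 4 * p ^ 2 + q ^ 2 in let k := 17 * p ^ 2 + 4 * q ^ 2 - 1 in
  k / 18 * (- L ^ 2 + 2 * D * L - 2 * L + 4 * D + 8 * (p * c) - 1)
  - 3 * D - 6 * (p * c) - 5.

Definition scaled_curvature (p q c s V eps : R) :=
  let E := 2 * p * s + q * c in
  let L := 4 * p ^ 2 + q ^ 2 in let k := 17 * p ^ 2 + 4 * q ^ 2 - 1 in
  scaled_curvature_0 p q c s - (7 + L) * V ^ 2 - V * ((9 + 2 * L) * E + 4 * (p * s))
  + scaled_curvature_1 p q c s * eps - k ^ 2 / 81 * (1 + L) * eps ^ 2.

(** [m * r] stands for [1 / m]. *)
Lemma curvature_formula (e : gen -> R) : on_state e ->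
  let x := e gx in let y := e gy in let m := e gm in
  let r := (9 / 4 - 2 * x ^ 2 - y ^ 2) / 2 in
  eval e curvature_ =
  m ^ 3 * scaled_curvature (x * m) (y * m) (e gc) (e gs) (e gv * (m * r)) (e gE * r ^ 2).
Proof.
intros [_ [_ [Hm Hc]]].
(* [y = Y / 2] makes the rewriting rules for [field] integral. *)
assert (Ey : exists Y, e gy = Y / 2) by (exists (2 * e gy); field).
destruct Ey as [Y Ey].
rewrite Ey in Hm |- *.
assert (H1 : e gm ^ 2 * Y ^ 2 = 9 * e gm ^ 2 - 8 * e gx ^ 2 * e gm ^ 2 - 8) by lra.
assert (H2 : e gs ^ 2 = 1 - e gc ^ 2) by lra.
unfold scaled_curvature, scaled_curvature_0, scaled_curvature_1; simpl.
rewrite !Ey.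
clear Hm Hc Ey.
generalize dependent (e gx); generalize dependent (e gc); generalize dependent (e gs).
generalize (e gv), (e gE); generalize dependent (e gm).
intros.
(* The rules eliminate m^2 Y^2 and s^2; modulo them the two sides agree. *)
field [H1 H2].
Qed.

(** The dangerous term is [L * D^2]. Written as [L^2 - L * E^2], it completes the [L]-part of the
    form in [V] to [- L * (V + E)^2]. What remains splits into a positive quadratic in [L], [D], [a]
    and a nonnegative one in [W = V + E], [E], [b], each a sum of squares up to a definite
    remainder. *)
Lemma V_form_neg (p q c s V : R) : c ^ 2 + s ^ 2 = 1 ->
  let E := 2 * p * s + q * c in let L := 4 * p ^ 2 + q ^ 2 in
  scaled_curvature_0 p q c s - (7 + L) * V ^ 2 - V * ((9 + 2 * L) * E + 4 * (p * s)) < 0.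
Proof.
intros H E L.
assert (Hs : s ^ 2 = 1 - c ^ 2) by lra.
set (D := 2 * p * c - q * s).
set (a := p * c); set (b := p * s).
assert (HL : L = D ^ 2 + E ^ 2) by (unfold L, D, E; ring [Hs]).
assert (Hp : p ^ 2 = a ^ 2 + b ^ 2) by (unfold a, b; ring [Hs]).
unfold scaled_curvature_0; fold D E L a b. rewrite Hp.
assert (L0 : 0 <= L) by (rewrite HL; nra).
set (W := V + E).
assert (Hid : - (L / 16) * (L - 2 * D) ^ 2 + L * D ^ 2 - 25 / 16 * L ^ 2 + L * (3 / 4 * D + a)
  - 35 / 16 * D ^ 2 - 79 / 16 * E ^ 2 - 4 * (a ^ 2 + b ^ 2) - 2 * E * b + D / 2 + a - 43 / 16
  - (7 + L) * V ^ 2 - V * ((9 + 2 * L) * E + 4 * b)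
  = - (L / 16) * (L - 2 * D) ^ 2 - L * W ^ 2
   - (9 / 16 * L ^ 2 - L * (3 / 4 * D + a) + 35 / 16 * D ^ 2 + 4 * a ^ 2 - D / 2 - a + 43 / 16)
   - (7 * W ^ 2 - W * (5 * E - 4 * b) + 47 / 16 * E ^ 2 + 4 * b ^ 2 - 2 * E * b)).
{ replace (L * D ^ 2) with (L * (L - E ^ 2)) by (rewrite HL; ring).
  unfold W; field. }
rewrite Hid.
assert (0 <= L / 16 * (L - 2 * D) ^ 2) by (apply Rmult_le_pos; [lra|apply pow2_ge_0]).
assert (0 <= L * W ^ 2) by (apply Rmult_le_pos; [lra|apply pow2_ge_0]).
assert (0 < 9 / 16 * L ^ 2 - L * (3 / 4 * D + a) + 35 / 16 * D ^ 2 + 4 * a ^ 2 - D / 2 - a + 43 / 16).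
{ clear -H. generalize L D a. clear. intros L D a.
  replace (9 / 16 * L ^ 2 - L * (3 / 4 * D + a) + 35 / 16 * D ^ 2 + 4 * a ^ 2 - D / 2 - a + 43 / 16) with
   (1 / 4 * (L - 3 / 2 * D) ^ 2 + 1 / 8 * (L - 4 * a) ^ 2 + 3 / 16 * L ^ 2 + 2 * (a - 1 / 4) ^ 2
     + (D - 1 / 4) ^ 2 + 5 / 8 * D ^ 2 + 5 / 2) by field.
  pose proof (pow2_ge_0 (L - 3 / 2 * D)). pose proof (pow2_ge_0 (L - 4 * a)).
  pose proof (pow2_ge_0 L). pose proof (pow2_ge_0 D). pose proof (pow2_ge_0 (a - 1 / 4)).
  pose proof (pow2_ge_0 (D - 1 / 4)). lra. }
assert (0 <= 7 * W ^ 2 - W * (5 * E - 4 * b) + 47 / 16 * E ^ 2 + 4 * b ^ 2 - 2 * E * b).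
{ generalize W E b. clear. intros W E b.
  replace (7 * W ^ 2 - W * (5 * E - 4 * b) + 47 / 16 * E ^ 2 + 4 * b ^ 2 - 2 * E * b) with
  (7 * (W - (5 * E - 4 * b) / 14) ^ 2 + (E - b / 2) ^ 2 + (47 / 16 - 25 / 28 - 1) * E ^ 2
     + (4 - 16 / 28 - 1 / 4) * b ^ 2 + (40 / 28 - 1) * E * b) by field.
  pose proof (pow2_ge_0 (W - (5 * E - 4 * b) / 14)). pose proof (pow2_ge_0 (E - b / 2)).
  pose proof (pow2_ge_0 (E + b)). nra. }
lra.
Qed.

(** An affine function on an interval is smallest at an endpoint; each use eliminates one variable
    of the box. *)
Lemma affine_pos (al be t D : R) :
  - t <= D <= t -> 0 < be + al * t -> 0 < be - al * t -> 0 < be + al * D.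
Proof. intros HD H1 H2. destruct (Rle_or_lt 0 al); nra. Qed.

(** The [eps] coefficient is affine in each of [p^2], [D], [b = 2 p c], so its
    sign is decided at the corners of the box they range over; there it is a
    polynomial in [t = sqrt (4 p^2 + q^2)]. *)
Lemma corner_pos (k t D b : R) : 4 <= k <= 17 / 4 -> 0 <= t -> - t <= D <= t -> - t <= b <= t ->
  0 < ((k * t ^ 2 - 1) * (t ^ 4 - 2 * D * t ^ 2 + 2 * t ^ 2 - 4 * D + 1) + 54 * D + 90)
      + (54 - 4 * (k * t ^ 2 - 1)) * b.
Proof.
intros Hk t0 HD Hb.
assert (t2 : 0 <= t ^ 2) by apply pow2_ge_0.
assert (t3 : 0 <= t ^ 3) by (apply pow_le; assumption).
assert (t4 : 0 <= t ^ 4) by (apply pow_le; assumption).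
assert (S1 : 0 <= k * (t ^ 4 * (t - 1) ^ 2))
  by (apply Rmult_le_pos; [lra|apply Rmult_le_pos; [assumption|apply pow2_ge_0]]).
assert (S2 : 0 <= k * (t ^ 4 * (t + 1) ^ 2))
  by (apply Rmult_le_pos; [lra|apply Rmult_le_pos; [assumption|apply pow2_ge_0]]).
assert (k2 : 0 <= (k - 4) * t ^ 2) by (apply Rmult_le_pos; lra).
assert (k3 : 0 <= (k - 4) * t ^ 3) by (apply Rmult_le_pos; lra).
assert (k4 : 0 <= (k - 4) * t ^ 4) by (apply Rmult_le_pos; lra).
(* First [b], then [D], is replaced by [t] or [- t], which leaves four corners. *)
apply (affine_pos _ _ t); [assumption| |].
- replace (_ + _ * t) with
    (((k * t ^ 2 - 1) * (t ^ 4 + 2 * t ^ 2 + 1) + 90 + (54 - 4 * (k * t ^ 2 - 1)) * t)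
     + (54 - (k * t ^ 2 - 1) * (2 * t ^ 2 + 4)) * D) by ring.
  apply (affine_pos _ _ t); [assumption| |].
  + replace (_ + _ * t) with
      (k * (t ^ 4 * (t - 1) ^ 2)
       + ((k - 1) * t ^ 4 + (2 - 8 * k) * t ^ 3 + (k - 2) * t ^ 2 + 116 * t + 89)) by ring.
    (* At the corner [b = D = t] the cubic term [(2 - 8 * k) * t^3] is the threat. Up to [19 / 10]
       the linear term absorbs it: for [k = 17 / 4] the loss is at most 32 * 3.61 t = 115.52 t,
       below [116 * t]. *)
    destruct (Rle_or_lt t (19 / 10)) as [Ht|Ht]; [|destruct (Rle_or_lt t 3) as [Ht3|Ht3]].
    * assert (t ^ 3 <= 361 / 100 * t) by nra.
      nra.
    * (* [6 t - 16] is the tangent of the convex [t (t - 1)^2 + t - 8] at [2]. *)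
      assert (0 <= t ^ 3 * (t * (t - 1) ^ 2 + t - 8 - (6 * t - 16))).
      { apply Rmult_le_pos; [assumption|].
        replace (t * (t - 1) ^ 2 + t - 8 - (6 * t - 16)) with ((t - 2) ^ 2 * (t + 2)) by ring.
        apply Rmult_le_pos; [apply pow2_ge_0|lra]. }
      (* This replaces [k] by 4; [23 / 20] is the greatest value of (k - 4) (16 - 6 t), reached at
         [k = 17 / 4], [t = 19 / 10]. *)
      assert (0 <= t ^ 3 * (k * (6 * t - 16) - (24 * t - 64 - 23 / 20))).
      { apply Rmult_le_pos; [assumption|nra]. }
      (* The terms of degree at least 3 are now bounded below by 23 t^4 - 63.15 t^3, and
         [1373 / 1000] is close to 63.15 / 46, which completes this to a square. *)
      pose proof (Rmult_le_pos _ _ t2 (pow2_ge_0 (t - 1373 / 1000))).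
      nra.
    (* This product collects all terms of degree at least 3; beyond 3 they are nonnegative by
       themselves. *)
    * assert (0 <= t ^ 3 * (k * (t * (t - 1) ^ 2 + t - 8) - (t - 2))).
      { apply Rmult_le_pos; [assumption|]. nra. }
      nra.
  + replace (_ - _ * t) with
      (k * (t ^ 4 * (t + 1) ^ 2)
       + ((k - 1) * t ^ 4 - 2 * t ^ 3 + (k - 2) * t ^ 2 + 89)) by ring.
    pose proof (Rmult_le_pos _ _ t2 (pow2_ge_0 (t - 1))). nra.
- replace (_ - _ * t) with
    (((k * t ^ 2 - 1) * (t ^ 4 + 2 * t ^ 2 + 1) + 90 - (54 - 4 * (k * t ^ 2 - 1)) * t)
     + (54 - (k * t ^ 2 - 1) * (2 * t ^ 2 + 4)) * D) by ring.
  apply (affine_pos _ _ t); [assumption| |].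
  + replace (_ + _ * t) with
      (k * (t ^ 4 * (t - 1) ^ 2)
       + ((k - 1) * t ^ 4 + 2 * t ^ 3 + (k - 2) * t ^ 2 + 89)) by ring.
    lra.
  + replace (_ - _ * t) with
      (k * (t ^ 4 * (t + 1) ^ 2)
       + ((k - 1) * t ^ 4 - (2 - 8 * k) * t ^ 3 + (k - 2) * t ^ 2 - 116 * t + 89)) by ring.
    (* At the corner [b = D = - t] only [- 116 * t] is negative; squares vanishing at [11 / 10] let
       the higher powers compensate it. *)
    pose proof (Rmult_le_pos _ _ t0 (pow2_ge_0 (t - 11 / 10))).
    pose proof (pow2_ge_0 (t - 11 / 10)). nra.
Qed.

(** [D] and [2 p c] are bounded by [t] because each is a component of a vector of length at most
    [t]. The extreme values [t^2 / 4] and 0 of [p^2] turn [4 t^2 + p^2] into [k t^2] with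
    [k = 17 / 4] and [k = 4], the two cases passed to [corner_pos]. *)
Lemma scaled_curvature_1_neg (p q c s : R) : c ^ 2 + s ^ 2 = 1 -> scaled_curvature_1 p q c s < 0.
Proof.
intros H. unfold scaled_curvature_1.
assert (Hs : s ^ 2 = 1 - c ^ 2) by lra.
set (D := 2 * p * c - q * s); set (a := p * c).
set (L := 4 * p ^ 2 + q ^ 2).
assert (L0 : 0 <= L) by (unfold L; nra).
set (t := sqrt L).
assert (t0 : 0 <= t) by apply sqrt_pos.
assert (HL : L = t ^ 2) by (unfold t; rewrite pow2_sqrt; auto).
assert (HD : - t <= D <= t).
{ assert (L = D ^ 2 + (2 * p * s + q * c) ^ 2) by (unfold L, D; ring [Hs]).
  pose proof (pow2_ge_0 (2 * p * s + q * c)).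
  split; nra. }
assert (Ha : - t <= 2 * a <= t).
{ assert (p ^ 2 = a ^ 2 + (p * s) ^ 2) by (unfold a; ring [Hs]).
  assert (L = 4 * p ^ 2 + q ^ 2) by reflexivity.
  pose proof (pow2_ge_0 (p * s)). pose proof (pow2_ge_0 q). split; nra. }
assert (Hp : - (t ^ 2) <= 8 * p ^ 2 - t ^ 2 <= t ^ 2).
{ rewrite <- HL. unfold L. split; nra. }
(* Recentring [p^2] makes its range symmetric, as [affine_pos] requires. *)
set (w := 8 * p ^ 2 - t ^ 2) in Hp.
assert (Ep : p ^ 2 = (w + t ^ 2) / 8) by (unfold w; field).
replace (17 * p ^ 2 + 4 * q ^ 2 - 1) with (4 * L + p ^ 2 - 1) by (unfold L; ring).
rewrite HL, Ep.
set (b := 2 * a) in Ha. replace a with (b / 2) by (unfold b; field).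
clearbody D b w t; clear - HD Ha Hp t0.
(* The expression is the coefficient multiplied by -18. *)
cut (0 < (4 * t ^ 2 + (w + t ^ 2) / 8 - 1) * (t ^ 4 - 2 * D * t ^ 2 + 2 * t ^ 2 - 4 * D - 4 * b + 1)
   + 54 * D + 54 * b + 90); [intros; nra|].
replace ((4 * t ^ 2 + (w + t ^ 2) / 8 - 1) * (t ^ 4 - 2 * D * t ^ 2 + 2 * t ^ 2 - 4 * D - 4 * b + 1)
   + 54 * D + 54 * b + 90) with
 ((((4 * t ^ 2 + (t ^ 2) / 8 - 1) * (t ^ 4 - 2 * D * t ^ 2 + 2 * t ^ 2 - 4 * D - 4 * b + 1)
   + 54 * D + 54 * b + 90)) + (t ^ 4 - 2 * D * t ^ 2 + 2 * t ^ 2 - 4 * D - 4 * b + 1) / 8 * w) by field.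
apply (affine_pos _ _ (t ^ 2)); [assumption| |].
- replace (_ + _ * t ^ 2) with
    (((17 / 4 * t ^ 2 - 1) * (t ^ 4 - 2 * D * t ^ 2 + 2 * t ^ 2 - 4 * D + 1) + 54 * D + 90)
     + (54 - 4 * (17 / 4 * t ^ 2 - 1)) * b) by field.
  apply corner_pos; [lra|assumption..].
- replace (_ - _ * t ^ 2) with
    (((4 * t ^ 2 - 1) * (t ^ 4 - 2 * D * t ^ 2 + 2 * t ^ 2 - 4 * D + 1) + 54 * D + 90)
     + (54 - 4 * (4 * t ^ 2 - 1)) * b) by field.
  apply corner_pos; [lra|assumption..].
Qed.

Lemma curvature_neg (e : gen -> R) : on_state e -> eval e curvature_ < 0.
Proof.
intros He. rewrite (curvature_formula e He).
destruct He as [Hm [HE [Hr Hc]]].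
set (r := (9 / 4 - 2 * e gx ^ 2 - e gy ^ 2) / 2).
assert (r0 : 0 < r) by (unfold r; pose proof (pow_lt _ 2 Hm); nra).
set (p := e gx * e gm); set (q := e gy * e gm).
set (V := e gv * (e gm * r)); set (eps := e gE * r ^ 2).
assert (Heps : 0 < eps) by (apply Rmult_lt_0_compat; [assumption|apply pow_lt; assumption]).
assert (m3 : 0 < e gm ^ 3) by (apply pow_lt; assumption).
cut (scaled_curvature p q (e gc) (e gs) V eps < 0); [nra|].
pose proof (V_form_neg p q (e gc) (e gs) V Hc) as H0.
pose proof (scaled_curvature_1_neg p q (e gc) (e gs) Hc) as H1.
unfold scaled_curvature. simpl in H0 |- *.
match type of H0 with ?A < 0 => set (g0 := A) in * end.
set (k := 17 * _ + _ - 1).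
assert (0 <= k ^ 2 / 81 * (1 + (4 * p ^ 2 + q ^ 2)) * eps ^ 2).
{ pose proof (pow2_ge_0 k); pose proof (pow2_ge_0 p); pose proof (pow2_ge_0 q).
  apply Rmult_le_pos; [apply Rmult_le_pos; lra|apply pow2_ge_0]. }
pose proof (Rmult_lt_0_compat _ _ Heps (Ropp_0_gt_lt_contravar _ H1)).
lra.
Qed.

(** * The Frobenius curvature *)

Definition state_env (x y u t v : R) (g : gen) : R :=
  match g with
  | gx => x
  | gy => y
  | gc => cos t
  | gs => sin t
  | gv => v
  | gE => rho u
  | gm => mu x y
  end.

Lemma mu_pos (x y : R) : 0 < Rfun x y -> 0 < mu x y.
Proof. intros H. apply sqrt_lt_R0, Rdiv_lt_0_compat; lra. Qed.

Lemma mu_sq (x y : R) : 0 < Rfun x y -> mu x y ^ 2 * Rfun x y = 2.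
Proof.
intros H. unfold mu. rewrite pow2_sqrt; [field; lra|].
apply Rlt_le, Rdiv_lt_0_compat; lra.
Qed.

Lemma is_derive_mu_x (x y : R) : 0 < Rfun x y ->
  is_derive (fun s => mu s y) x (x * mu x y ^ 3).
Proof.
intros H. pose proof (mu_pos x y H) as Hm. pose proof (mu_sq x y H) as Hr.
assert (HR : Rfun x y = 2 / mu x y ^ 2) by (rewrite <- Hr; field; lra).
assert (H2 : 0 < 2 / Rfun x y) by (apply Rdiv_lt_0_compat; lra).
unfold mu. evar_last.
- apply (is_derive_comp sqrt (fun s => 2 / Rfun s y)).
  + apply is_derive_Reals, derivable_pt_lim_sqrt; exact H2.
  + unfold Rfun in *. auto_derive; [lra|reflexivity].
- fold (mu x y).
  unfold scal; simpl; unfold mult; simpl.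
  replace (9 / 4 + - (2 * (x * (x * 1))) + - (y * (y * 1))) with (Rfun x y)
    by (unfold Rfun; ring).
  rewrite HR. field. lra.
Qed.

Lemma is_derive_mu_y (x y : R) : 0 < Rfun x y ->
  is_derive (fun s => mu x s) y (y / 2 * mu x y ^ 3).
Proof.
intros H. pose proof (mu_pos x y H) as Hm. pose proof (mu_sq x y H) as Hr.
assert (HR : Rfun x y = 2 / mu x y ^ 2) by (rewrite <- Hr; field; lra).
assert (H2 : 0 < 2 / Rfun x y) by (apply Rdiv_lt_0_compat; lra).
unfold mu. evar_last.
- apply (is_derive_comp sqrt (fun s => 2 / Rfun x s)).
  + apply is_derive_Reals, derivable_pt_lim_sqrt; exact H2.
  + unfold Rfun in *. auto_derive; [lra|reflexivity].
- fold (mu x y).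
  unfold scal; simpl; unfold mult; simpl.
  replace (9 / 4 - 2 * (x * (x * 1)) + - (y * (y * 1))) with (Rfun x y)
    by (unfold Rfun; ring).
  rewrite HR. field. lra.
Qed.

Lemma state_env_on_state (x y u t v : R) :
  0 < Rfun x y -> on_state (state_env x y u t v).
Proof.
intros H; repeat split; simpl.
- apply mu_pos; assumption.
- apply exp_pos.
- apply (mu_sq x y H).
- pose proof (sin2_cos2 t) as E; unfold Rsqr in E; lra.
Qed.

Lemma Rfun_pos_near_x (x y : R) : 0 < Rfun x y -> locally x (fun s => 0 < Rfun s y).
Proof.
intros H.
assert (Hc : continuous (fun s => Rfun s y) x).
{ apply @ex_derive_continuous. unfold Rfun. auto_derive. trivial. }
apply (Hc (fun r => 0 < r)), (open_gt 0), H.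
Qed.

Lemma Rfun_pos_near_y (x y : R) : 0 < Rfun x y -> locally y (fun s => 0 < Rfun x s).
Proof.
intros H.
assert (Hc : continuous (fun s => Rfun x s) y).
{ apply @ex_derive_continuous. unfold Rfun. auto_derive. trivial. }
apply (Hc (fun r => 0 < r)), (open_gt 0), H.
Qed.

(** Agreement is asked only where R > 0, since there 1 / R = mu^2 / 2. This region is open, so
    derivatives agree as well. *)
Definition represents (F : R -> R -> R -> R -> R -> R) (F_ : pexp) : Prop :=
  forall x y u t v, 0 < Rfun x y -> F x y u t v = eval (state_env x y u t v) F_.

(** The chain rule through the generators: a vector field acts on a represented function as the
    formal derivation with matching images. The last two equations encode d rho = 2 rho du and dmu =
    mu^3 (x dx + (y / 2) dy). Taking [kv = 0] covers the total derivatives. *)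
Lemma derivation_eval (F : R -> R -> R -> R -> R -> R) (F_ : pexp)
    (x y u t v kx ky ku kt kv : R) (delta : gen -> pexp) :
  represents F F_ -> 0 < Rfun x y ->
  let e := state_env x y u t v in
  kx = eval e (delta gx) -> ky = eval e (delta gy) ->
  kt * - sin t = eval e (delta gc) -> kt * cos t = eval e (delta gs) ->
  kv = eval e (delta gv) -> 2 * ku * rho u = eval e (delta gE) ->
  (kx * x + ky * (y / 2)) * mu x y ^ 3 = eval e (delta gm) ->
  kx * Derive (fun s => F s y u t v) x
  + ky * Derive (fun s => F x s u t v) y
  + ku * Derive (fun s => F x y s t v) u
  + kt * Derive (fun s => F x y u s v) t
  + kv * Derive (fun s => F x y u t s) v = eval e (der delta F_).
Proof.
intros HF H e Ex Ey Ec Es Ev EE Em.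
set (ex g := match g with gx => 1 | gm => x * mu x y ^ 3 | _ => 0 end).
set (ey g := match g with gy => 1 | gm => y / 2 * mu x y ^ 3 | _ => 0 end).
set (eu g := match g with gE => 2 * rho u | _ => 0 end).
set (et g := match g with gc => - sin t | gs => cos t | _ => 0 end).
set (ev g := match g with gv => 1 | _ => 0 end).
assert (Dx : Derive (fun s => F s y u t v) x = tangent e ex F_).
{ apply is_derive_unique.
  apply (is_derive_ext_loc (fun s => eval (state_env s y u t v) F_)).
  - apply (filter_imp (fun s => 0 < Rfun s y)); [|apply Rfun_pos_near_x; exact H].
    intros s Hs; symmetry; apply HF, Hs.
  - apply (is_derive_eval (fun s => state_env s y u t v)).
    intros []; simpl; try apply @is_derive_const; [apply @is_derive_id|].
    apply is_derive_mu_x, H. }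
assert (Dy : Derive (fun s => F x s u t v) y = tangent e ey F_).
{ apply is_derive_unique.
  apply (is_derive_ext_loc (fun s => eval (state_env x s u t v) F_)).
  - apply (filter_imp (fun s => 0 < Rfun x s)); [|apply Rfun_pos_near_y; exact H].
    intros s Hs; symmetry; apply HF, Hs.
  - apply (is_derive_eval (fun s => state_env x s u t v)).
    intros []; simpl; try apply @is_derive_const; [apply @is_derive_id|].
    apply is_derive_mu_y, H. }
assert (Du : Derive (fun s => F x y s t v) u = tangent e eu F_).
{ apply is_derive_unique.
  apply (is_derive_ext (fun s => eval (state_env x y s t v) F_)).
  - intros s; symmetry; apply HF, H.
  - apply (is_derive_eval (fun s => state_env x y s t v)).
    intros []; simpl; try apply @is_derive_const.
    unfold rho; auto_derive; [trivial|ring]. }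
assert (Dt : Derive (fun s => F x y u s v) t = tangent e et F_).
{ apply is_derive_unique.
  apply (is_derive_ext (fun s => eval (state_env x y u s v) F_)).
  - intros s; symmetry; apply HF, H.
  - apply (is_derive_eval (fun s => state_env x y u s v)).
    intros []; simpl; try apply @is_derive_const; auto_derive; trivial; ring. }
assert (Dv : Derive (fun s => F x y u t s) v = tangent e ev F_).
{ apply is_derive_unique.
  apply (is_derive_ext (fun s => eval (state_env x y u t s) F_)).
  - intros s; symmetry; apply HF, H.
  - apply (is_derive_eval (fun s => state_env x y u t s)).
    intros []; simpl; try apply @is_derive_const. apply @is_derive_id. }
rewrite Dx, Dy, Du, Dt, Dv, eval_der.
rewrite <- !tangent_scale, <- !tangent_add.
apply tangent_ext.
intros []; simpl;
  rewrite <- ?Ex, <- ?Ey, <- ?Ec, <- ?Es, <- ?Ev, <- ?EE, <- ?Em; field.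
Qed.

Lemma coef_a_represented : represents (fun x y u t _ => coef_a x y u t) a_.
Proof.
intros x y u t v H; unfold coef_a; simpl.
replace (9 / 4 + -1 * (2 * (x * x)) + -1 * (y * y)) with (Rfun x y) by (unfold Rfun; ring).
replace (2 * (x * x) + 1 / 2 * (y * y) + -1 * (1 / 8)) with (Kfun x y)
  by (unfold Kfun; field).
unfold coef_d.
pose proof (mu_pos x y H) as Hm.
replace (Rfun x y) with (2 / mu x y ^ 2) by (rewrite <- (mu_sq x y H); field; lra).
field. lra.
Qed.

Lemma inv_Rfun (x y : R) : 0 < Rfun x y -> / Rfun x y = 1 / 2 * (mu x y * mu x y).
Proof.
intros H; pose proof (mu_sq x y H).
apply (Rmult_eq_reg_l (Rfun x y)); [rewrite Rinv_r by lra|]; lra.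
Qed.

Lemma coef_P_represented : represents (fun x y u t _ => coef_P x y u t) P_.
Proof.
intros x y u t v H; unfold coef_P, P_, Rdiv.
rewrite (coef_a_represented x y u t v H), inv_Rfun by assumption.
unfold coef_d. simpl. field.
Qed.

Lemma coef_eR_represented : represents (fun x y u t _ => coef_e x y t / Rfun x y) eR_.
Proof.
intros x y u t v H; unfold Rdiv. rewrite inv_Rfun by assumption.
unfold coef_e; simpl; ring.
Qed.

Lemma coef_B_represented : represents coef_B B_.
Proof.
intros x y u t v H; unfold coef_B.
rewrite (coef_eR_represented x y u t v H). simpl; ring.
Qed.

Lemma total_X_eval (F : R -> R -> R -> R -> R) (F_ : pexp) (x y u t v : R) :
  represents (fun x y u t _ => F x y u t) F_ -> 0 < Rfun x y ->
  total_X F x y u t v = eval (state_env x y u t v) (der (X_images (Const 0)) F_).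
Proof.
intros HF H.
rewrite <- (derivation_eval _ F_ x y u t v (cos t) (- sin t) (coef_P x y u t)
  (coef_B x y u t v) 0 _ HF H); unfold total_X; [ring|..];
  rewrite ?(coef_P_represented x y u t v H), ?(coef_B_represented x y u t v H);
  cbn [X_images eval x_ y_ c_ s_ v_ E_ m_ state_env]; unfold Rdiv; try field.
Qed.

Lemma total_Y_eval (F : R -> R -> R -> R -> R) (F_ : pexp) (x y u t v : R) :
  represents (fun x y u t _ => F x y u t) F_ -> 0 < Rfun x y ->
  total_Y F x y u t v = eval (state_env x y u t v) (der (Y_images (Const 0)) F_).
Proof.
intros HF H.
rewrite <- (derivation_eval _ F_ x y u t v (- sin t) (- cos t) v
  (- coef_a x y u t) 0 _ HF H); unfold total_Y; [ring|..];
  rewrite ?(coef_a_represented x y u t v H);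
  cbn [Y_images eval x_ y_ c_ s_ v_ E_ m_ state_env]; unfold Rdiv; try field.
Qed.

Lemma coef_f_represented : represents coef_f f_.
Proof.
intros x y u t v H; unfold coef_f, f_.
rewrite (total_Y_eval _ _ x y u t v coef_P_represented H).
rewrite (coef_P_represented x y u t v H), (coef_B_represented x y u t v H),
  (coef_a_represented x y u t v H).
cbn [eval v_ state_env]; ring.
Qed.

Lemma coef_g_represented : represents coef_g g_.
Proof.
intros x y u t v H; unfold coef_g, g_.
rewrite (total_X_eval _ _ x y u t v coef_a_represented H).
rewrite (total_Y_eval _ _ x y u t v coef_eR_represented H).
rewrite (coef_B_represented x y u t v H), (coef_a_represented x y u t v H).
cbn [eval]; ring.
Qed.

Lemma frobenius_curvature_represented : represents frobenius_curvature curvature_.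
Proof.
intros x y u t v H; unfold frobenius_curvature, curvature_.
cbn [eval].
rewrite <- (derivation_eval _ g_ x y u t v (cos t) (- sin t) (coef_P x y u t)
  (coef_B x y u t v) (coef_f x y u t v) (X_images f_) coef_g_represented H).
rewrite <- (derivation_eval _ f_ x y u t v (- sin t) (- cos t) v
  (- coef_a x y u t) (coef_g x y u t v) (Y_images g_) coef_f_represented H).
{ unfold field_X, field_Y.
  rewrite <- (coef_f_represented x y u t v H), <- (coef_g_represented x y u t v H),
    <- (coef_B_represented x y u t v H), <- (coef_a_represented x y u t v H).
  ring. }
all: rewrite ?(coef_f_represented x y u t v H), ?(coef_g_represented x y u t v H),
    ?(coef_P_represented x y u t v H), ?(coef_B_represented x y u t v H),
    ?(coef_a_represented x y u t v H);
  cbn [X_images Y_images eval x_ y_ c_ s_ v_ E_ m_ state_env]; unfold Rdiv; field.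
Qed.

Lemma frobenius_curvature_neg (x y u t v : R) :
  0 < Rfun x y -> frobenius_curvature x y u t v < 0.
Proof.
intros H; rewrite (frobenius_curvature_represented x y u t v H).
apply curvature_neg, state_env_on_state, H.
Qed.

(** * Smooth functions on an open set *)

(** The boolean selects the variable: [true] for [x], [false] for [y]. *)
Definition slice (i : bool) (h : R -> R -> R) (x y : R) : R -> R :=
  if i then fun z => h z y else fun z => h x z.

Definition base (i : bool) (x y : R) : R := if i then x else y.

Definition is_partial (i : bool) (h : R -> R -> R) (x y l : R) : Prop :=
  is_derive (slice i h x y) (base i x y) l.

Definition partial (i : bool) (h : R -> R -> R) (x y : R) : R :=
  Derive (slice i h x y) (base i x y).

Lemma partial_unique i h x y l : is_partial i h x y l -> partial i h x y = l.
Proof. apply is_derive_unique. Qed.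

Lemma is_partial_eq i h x y l l' : is_partial i h x y l -> l = l' -> is_partial i h x y l'.
Proof. intros H <-; exact H. Qed.

Lemma is_partial_const i k x y : is_partial i (fun _ _ => k) x y 0.
Proof. destruct i; apply @is_derive_const. Qed.

Lemma is_partial_fst i x y : is_partial i (fun x _ => x) x y (if i then 1 else 0).
Proof. destruct i; [apply @is_derive_id|apply @is_derive_const]. Qed.

Lemma is_partial_snd i x y : is_partial i (fun _ y => y) x y (if i then 0 else 1).
Proof. destruct i; [apply @is_derive_const|apply @is_derive_id]. Qed.

Lemma is_partial_plus i f g x y a b :
  is_partial i f x y a -> is_partial i g x y b -> is_partial i (fun x y => f x y + g x y) x y (a + b).
Proof. destruct i; apply @is_derive_plus. Qed.

Lemma is_partial_opp i f x y a : is_partial i f x y a -> is_partial i (fun x y => - f x y) x y (- a).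
Proof. destruct i; apply @is_derive_opp. Qed.

Lemma is_partial_minus i f g x y a b :
  is_partial i f x y a -> is_partial i g x y b -> is_partial i (fun x y => f x y - g x y) x y (a - b).
Proof. destruct i; apply @is_derive_minus. Qed.

Lemma is_partial_mult i f g x y a b :
  is_partial i f x y a -> is_partial i g x y b ->
  is_partial i (fun x y => f x y * g x y) x y (a * g x y + f x y * b).
Proof.
destruct i; intros Hf Hg;
  apply (is_derive_mult _ _ _ _ _ Hf Hg); intros; apply Rmult_comm.
Qed.

Lemma is_partial_comp i (phi : R -> R) f x y a l :
  is_derive phi (f x y) l -> is_partial i f x y a -> is_partial i (fun x y => phi (f x y)) x y (a * l).
Proof.
destruct i; intros Hp Hf; [apply (is_derive_comp phi (fun z => f z y))
  |apply (is_derive_comp phi (fun z => f x z))]; assumption.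
Qed.

Lemma is_partial_mu i x y : 0 < Rfun x y ->
  is_partial i mu x y ((if i then x else y / 2) * mu x y ^ 3).
Proof. destruct i; [apply is_derive_mu_x|apply is_derive_mu_y]. Qed.

Lemma is_partial_eval i (path : R -> R -> gen -> R) e' x y F :
  (forall g, is_partial i (fun x y => path x y g) x y (e' g)) ->
  is_partial i (fun x y => eval (path x y) F) x y (tangent (path x y) e' F).
Proof.
destruct i; intros H; [apply (is_derive_eval (fun z => path z y))
  |apply (is_derive_eval (fun z => path x z))]; exact H.
Qed.

Section OpenSet.

Variable Omega : R * R -> Prop.
Hypothesis Omega_open : open Omega.

Lemma locally_2d_Omega (x y : R) (P : R -> R -> Prop) :
  Omega (x, y) -> (forall a b, Omega (a, b) -> P a b) -> locally_2d P x y.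
Proof.
intros H HP. apply locally_2d_locally.
apply (filter_imp Omega); [intros [a b]; apply HP|apply Omega_open, H].
Qed.

Lemma partial_ext i f g x y : Omega (x, y) ->
  (forall a b, Omega (a, b) -> f a b = g a b) -> partial i f x y = partial i g x y.
Proof.
intros H Hfg; pose proof (locally_2d_Omega x y _ H Hfg) as Hn.
destruct i; apply Derive_ext_loc;
  [apply (locally_2d_1d_const_y _ _ _ Hn)|apply (locally_2d_1d_const_x _ _ _ Hn)].
Qed.

(** [smooth_on] at a single order, on which the closure properties go by induction. *)
Definition Cn (n : nat) (h : R -> R -> R) : Prop :=
  forall x y, Omega (x, y) -> ex_diff_n h n x y.

Lemma Cn_ext n f g :
  (forall a b, Omega (a, b) -> f a b = g a b) -> Cn n f -> Cn n g.
Proof.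
intros Hfg Hf x y H. apply (ex_diff_n_ext_loc f); [apply locally_2d_Omega; assumption|apply Hf, H].
Qed.

Lemma Cn_pred n f : Cn (S n) f -> Cn n f.
Proof. intros Hf x y H. apply (ex_diff_n_m (S n)); [lia|apply Hf, H]. Qed.

Lemma Cn_continuity n f x y : Cn n f -> Omega (x, y) -> continuity_2d_pt f x y.
Proof. intros Hf H. specialize (Hf x y H). destruct n; apply Hf. Qed.

Lemma Cn_is_partial n i f x y : Cn (S n) f -> Omega (x, y) -> is_partial i f x y (partial i f x y).
Proof.
intros Hf H. destruct (Hf x y H) as [_ [Hx [Hy _]]].
destruct i; apply Derive_correct; assumption.
Qed.

Lemma Cn_partial n i f : Cn (S n) f -> Cn n (partial i f).
Proof.
intros Hf x y H. destruct (Hf x y H) as [_ [_ [_ [Hx Hy]]]].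
destruct i; assumption.
Qed.

(** [ex_diff_n] recurses on [Derive]; as [Omega] is open, explicit formulas for the partial
    derivatives on [Omega] may take its place. *)
Lemma Cn_step n f (f' : bool -> R -> R -> R) :
  (forall x y, Omega (x, y) -> continuity_2d_pt f x y) ->
  (forall i x y, Omega (x, y) -> is_partial i f x y (f' i x y)) ->
  (forall i, Cn n (f' i)) -> Cn (S n) f.
Proof.
intros Hc Hd Hn.
assert (HD : forall i, Cn n (partial i f)).
{ intros i. apply (Cn_ext n (f' i)); [|apply Hn].
  intros a b H; symmetry; apply partial_unique, Hd, H. }
intros x y H. split; [apply Hc, H|].
split; [exists (f' true x y); apply (Hd true), H|].
split; [exists (f' false x y); apply (Hd false), H|].
split; [apply (HD true), H|apply (HD false), H].
Qed.

Lemma Cn_const n k : Cn n (fun _ _ => k).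
Proof.
revert k; induction n as [|n IH]; intros k.
- intros x y _; split; [apply continuity_2d_pt_const|trivial].
- apply (Cn_step n _ (fun _ _ _ => 0)).
  + intros; apply continuity_2d_pt_const.
  + intros; apply is_partial_const.
  + intros; apply IH.
Qed.

Lemma Cn_fst n : Cn n (fun x _ => x).
Proof.
destruct n as [|n].
- intros x y _; split; [apply continuity_2d_pt_id1|trivial].
- apply (Cn_step n _ (fun i _ _ => if i then 1 else 0)).
  + intros; apply continuity_2d_pt_id1.
  + intros; apply is_partial_fst.
  + intros; apply Cn_const.
Qed.

Lemma Cn_snd n : Cn n (fun _ y => y).
Proof.
destruct n as [|n].
- intros x y _; split; [apply continuity_2d_pt_id2|trivial].
- apply (Cn_step n _ (fun i _ _ => if i then 0 else 1)).
  + intros; apply continuity_2d_pt_id2.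
  + intros; apply is_partial_snd.
  + intros; apply Cn_const.
Qed.

Lemma Cn_plus n f g : Cn n f -> Cn n g -> Cn n (fun x y => f x y + g x y).
Proof.
revert f g; induction n as [|n IH]; intros f g Hf Hg.
- intros x y H; split; [apply continuity_2d_pt_plus; [apply (Hf x y H)|apply (Hg x y H)]|trivial].
- apply (Cn_step n _ (fun i x y => partial i f x y + partial i g x y)).
  + intros x y H; apply continuity_2d_pt_plus; eapply Cn_continuity; eassumption.
  + intros; apply is_partial_plus; eapply Cn_is_partial; eassumption.
  + intros; apply IH; apply Cn_partial; assumption.
Qed.

Lemma Cn_mult n f g : Cn n f -> Cn n g -> Cn n (fun x y => f x y * g x y).
Proof.
revert f g; induction n as [|n IH]; intros f g Hf Hg.
- intros x y H; split; [apply continuity_2d_pt_mult; [apply (Hf x y H)|apply (Hg x y H)]|trivial].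
- apply (Cn_step n _ (fun i x y => partial i f x y * g x y + f x y * partial i g x y)).
  + intros x y H; apply continuity_2d_pt_mult; eapply Cn_continuity; eassumption.
  + intros; apply is_partial_mult; eapply Cn_is_partial; eassumption.
  + intros; apply Cn_plus; apply IH; (apply Cn_partial || apply Cn_pred); assumption.
Qed.

Lemma Cn_exp n f : Cn n f -> Cn n (fun x y => exp (f x y)).
Proof.
assert (Hc : forall n x y, Cn n f -> Omega (x, y) ->
  continuity_2d_pt (fun x y => exp (f x y)) x y).
{ intros k x y Hk H. apply (continuity_1d_2d_pt_comp exp).
  - apply derivable_continuous, derivable_exp.
  - eapply Cn_continuity; eassumption. }
induction n as [|n IH]; intros Hf.
- intros x y H; split; [eapply Hc; eassumption|trivial].
- apply (Cn_step n _ (fun i x y => partial i f x y * exp (f x y))).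
  + intros; eapply Hc; eassumption.
  + intros; apply is_partial_comp; [apply is_derive_exp|eapply Cn_is_partial; eassumption].
  + intros; apply Cn_mult; [apply Cn_partial, Hf|apply IH, Cn_pred, Hf].
Qed.

Hypothesis Omega_R : forall x y, Omega (x, y) -> 0 < Rfun x y.

Lemma Cn_Rfun n : Cn n Rfun.
Proof.
apply (Cn_ext n (fun x y => 9 / 4 + (-2 * (x * x) + -1 * (y * y)))).
- intros; unfold Rfun; ring.
- repeat first [apply Cn_const | apply Cn_fst | apply Cn_snd | apply Cn_plus | apply Cn_mult].
Qed.

(** The partial derivatives of mu are polynomials in x, y and mu, so the induction closes once mu is
    known to be continuous. *)
Lemma Cn_mu n : Cn n mu.
Proof.
assert (Hc : forall x y, Omega (x, y) -> continuity_2d_pt mu x y).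
{ intros x y H. apply Omega_R in H as HR.
  apply (continuity_1d_2d_pt_comp (fun r => sqrt (2 / r)) Rfun).
  - apply continuity_pt_filterlim.
    apply (@ex_derive_continuous R_AbsRing R_NormedModule (fun r => sqrt (2 / r)) (Rfun x y)).
    auto_derive. assert (0 < 2 * / Rfun x y) by (apply Rdiv_lt_0_compat; lra).
    repeat split; lra.
  - apply (Cn_continuity 0); [apply Cn_Rfun|assumption]. }
induction n as [|n IH].
- intros x y H; split; [apply Hc, H|trivial].
- apply (Cn_step n _ (fun i x y => (if i then x else 1 / 2 * y) * (mu x y * (mu x y * mu x y)))).
  + exact Hc.
  + intros i x y H. eapply is_partial_eq; [apply is_partial_mu, Omega_R, H|destruct i; field].
  + intros i; apply Cn_mult; [|repeat apply Cn_mult; apply IH].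
    destruct i; [apply Cn_fst|apply Cn_mult; [apply Cn_const|apply Cn_snd]].
Qed.

Local Notation smooth := (smooth_on Omega).

Lemma smooth_Cn n f : smooth f -> Cn n f.
Proof. intros Hf; exact (Hf n). Qed.

Lemma smooth_is_partial i f x y : smooth f -> Omega (x, y) -> is_partial i f x y (partial i f x y).
Proof. intros Hf; apply (Cn_is_partial 0), smooth_Cn, Hf. Qed.

Lemma smooth_partial i f : smooth f -> smooth (partial i f).
Proof. intros Hf n; apply Cn_partial, smooth_Cn, Hf. Qed.

Lemma smooth_const k : smooth (fun _ _ => k).
Proof. intros n; apply Cn_const. Qed.

Lemma smooth_fst : smooth (fun x _ => x).
Proof. intros n; apply Cn_fst. Qed.

Lemma smooth_snd : smooth (fun _ y => y).
Proof. intros n; apply Cn_snd. Qed.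

Lemma smooth_plus f g : smooth f -> smooth g -> smooth (fun x y => f x y + g x y).
Proof. intros Hf Hg n; apply Cn_plus; apply smooth_Cn; assumption. Qed.

Lemma smooth_mult f g : smooth f -> smooth g -> smooth (fun x y => f x y * g x y).
Proof. intros Hf Hg n; apply Cn_mult; apply smooth_Cn; assumption. Qed.

Lemma smooth_ext f g : (forall a b, Omega (a, b) -> f a b = g a b) -> smooth f -> smooth g.
Proof. intros Hfg Hf n; apply (Cn_ext n f); [exact Hfg|apply smooth_Cn, Hf]. Qed.

Lemma smooth_opp f : smooth f -> smooth (fun x y => - f x y).
Proof.
intros Hf; apply (smooth_ext (fun x y => -1 * f x y)); [intros; ring|].
apply smooth_mult; [apply smooth_const|exact Hf].
Qed.

Lemma smooth_minus f g : smooth f -> smooth g -> smooth (fun x y => f x y - g x y).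
Proof. intros Hf Hg; apply smooth_plus; [exact Hf|apply smooth_opp, Hg]. Qed.

Lemma smooth_exp f : smooth f -> smooth (fun x y => exp (f x y)).
Proof. intros Hf n; apply Cn_exp, smooth_Cn, Hf. Qed.

Lemma smooth_mu : smooth mu.
Proof. intros n; apply Cn_mu. Qed.

Lemma partial_comm f x y : smooth f -> Omega (x, y) ->
  partial true (partial false f) x y = partial false (partial true f) x y.
Proof.
intros Hf H. apply (Schwarz f x y).
- apply locally_2d_Omega; [exact H|]. intros a b Hab. repeat split.
  + exact (ex_intro _ _ (smooth_is_partial true f a b Hf Hab)).
  + exact (ex_intro _ _ (smooth_is_partial false f a b Hf Hab)).
  + exact (ex_intro _ _ (smooth_is_partial true (partial false f) a b (smooth_partial _ _ Hf) Hab)).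
  + exact (ex_intro _ _ (smooth_is_partial false (partial true f) a b (smooth_partial _ _ Hf) Hab)).
- apply (Cn_continuity 0 (partial true (partial false f)));
    [apply smooth_Cn, smooth_partial, smooth_partial, Hf|exact H].
- apply (Cn_continuity 0 (partial false (partial true f)));
    [apply smooth_Cn, smooth_partial, smooth_partial, Hf|exact H].
Qed.

Ltac solve_smooth :=
  lazymatch goal with
  | |- smooth (fun x y => @?f x y + @?g x y) => apply (smooth_plus f g); solve_smooth
  | |- smooth (fun x y => @?f x y - @?g x y) => apply (smooth_minus f g); solve_smooth
  | |- smooth (fun x y => @?f x y * @?g x y) => apply (smooth_mult f g); solve_smooth
  | |- smooth (fun x y => - @?f x y) => apply (smooth_opp f); solve_smooth
  | |- smooth (fun x y => exp (@?f x y)) => apply (smooth_exp f); solve_smooth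
  | |- smooth (fun _ _ => ?k) => apply (smooth_const k)
  | |- smooth (fun x _ => x) => apply smooth_fst
  | |- smooth (fun _ y => y) => apply smooth_snd
  | |- smooth (fun x y => partial ?i ?f x y) => apply (smooth_partial i f); solve_smooth
  | |- smooth (partial ?i ?f) => apply (smooth_partial i f); solve_smooth
  | |- smooth mu => apply smooth_mu
  | |- smooth (fun x y => mu x y) => apply smooth_mu
  | |- _ => assumption
  end.

Ltac derive_partial :=
  lazymatch goal with
  | |- is_partial _ (fun x y => @?f x y + @?g x y) _ _ _ => apply (is_partial_plus _ f g); derive_partial
  | |- is_partial _ (fun x y => @?f x y - @?g x y) _ _ _ => apply (is_partial_minus _ f g); derive_partial
  | |- is_partial _ (fun x y => @?f x y * @?g x y) _ _ _ => apply (is_partial_mult _ f g); derive_partial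
  | |- is_partial _ (fun x y => - @?f x y) _ _ _ => apply (is_partial_opp _ f); derive_partial
  | |- is_partial _ (fun _ _ => ?k) _ _ _ => apply (is_partial_const _ k)
  | |- is_partial _ (fun x _ => x) _ _ _ => apply is_partial_fst
  | |- is_partial _ (fun _ y => y) _ _ _ => apply is_partial_snd
  | |- is_partial ?i (fun x y => ?f x y) _ _ _ => apply (smooth_is_partial i f); [solve_smooth|assumption]
  | |- is_partial ?i ?f _ _ _ => apply (smooth_is_partial i f); [solve_smooth|assumption]
  end.

Tactic Notation "derive_by" tactic(t) :=
  eapply partial_unique; eapply is_partial_eq; [derive_partial | t].

(** * The frame of a solution *)

Variables c s u : R -> R -> R.
Hypothesis smooth_c : smooth c.
Hypothesis smooth_s : smooth s.
Hypothesis smooth_u : smooth u.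
Hypothesis circle : forall x y, Omega (x, y) -> c x y ^ 2 + s x y ^ 2 = 1.

(** The partial derivative of the angle of [c + i s]. *)
Definition turn (i : bool) (x y : R) : R := c x y * partial i s x y - s x y * partial i c x y.

(** Differentiating [c^2 + s^2 = 1] shows that the derivative of [(c, s)] is tangent to the circle,
    hence [turn] times [(- s, c)]. *)
Lemma partial_c i x y : Omega (x, y) -> partial i c x y = - s x y * turn i x y.
Proof.
intros H. pose proof (circle x y H) as Hc. unfold turn.
assert (E : partial i (fun x y => c x y * c x y + s x y * s x y) x y = 0).
{ rewrite (partial_ext i _ (fun _ _ => 1) x y H); [apply partial_unique, is_partial_const|].
  intros a b Hab; rewrite <- (circle a b Hab); ring. }
erewrite partial_unique in E; [|derive_partial].
assert (Hs : s x y ^ 2 = 1 - c x y ^ 2) by lra.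
assert (E' : s x y * partial i s x y = - c x y * partial i c x y) by lra.
replace (- s x y * (c x y * partial i s x y - s x y * partial i c x y))
  with (- c x y * (s x y * partial i s x y) + s x y ^ 2 * partial i c x y) by ring.
rewrite E', Hs; ring.
Qed.

Lemma partial_s i x y : Omega (x, y) -> partial i s x y = c x y * turn i x y.
Proof.
intros H. pose proof (circle x y H) as Hc. unfold turn.
assert (E : partial i (fun x y => c x y * c x y + s x y * s x y) x y = 0).
{ rewrite (partial_ext i _ (fun _ _ => 1) x y H); [apply partial_unique, is_partial_const|].
  intros a b Hab; rewrite <- (circle a b Hab); ring. }
erewrite partial_unique in E; [|derive_partial].
assert (Hs : c x y ^ 2 = 1 - s x y ^ 2) by lra.
assert (E' : c x y * partial i c x y = - s x y * partial i s x y) by lra.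
replace (c x y * (c x y * partial i s x y - s x y * partial i c x y))
  with (- s x y * (c x y * partial i c x y) + c x y ^ 2 * partial i s x y) by ring.
rewrite E', Hs; ring.
Qed.

Lemma smooth_turn i : smooth (turn i).
Proof. unfold turn; solve_smooth. Qed.

(** Mixed second derivatives cancel by symmetry; the remaining first-order terms form a Jacobian of
    [(c, s)], which vanishes because both gradients are multiples of [turn]. *)
Lemma turn_closed x y : Omega (x, y) -> partial false (turn true) x y = partial true (turn false) x y.
Proof.
intros H.
assert (E1 : partial false (turn true) x y =
  partial false c x y * partial true s x y + c x y * partial false (partial true s) x y
  - (partial false s x y * partial true c x y + s x y * partial false (partial true c) x y))
  by (unfold turn; derive_by reflexivity).
assert (E2 : partial true (turn false) x y =
  partial true c x y * partial false s x y + c x y * partial true (partial false s) x y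
  - (partial true s x y * partial false c x y + s x y * partial true (partial false c) x y))
  by (unfold turn; derive_by reflexivity).
rewrite E1, E2, !partial_comm, !partial_c, !partial_s by (solve_smooth; assumption). ring.
Qed.

Definition frame_X (h : R -> R -> R) (x y : R) : R :=
  c x y * partial true h x y - s x y * partial false h x y.

Definition frame_Y (h : R -> R -> R) (x y : R) : R :=
  - s x y * partial true h x y - c x y * partial false h x y.

(** [h1 dx + h2 dy] is a closed form, to be applied to [du], [dv] and to the
    differential of the angle, which is not given as a function. *)
Lemma frame_commutator h1 h2 x y : smooth h1 -> smooth h2 -> Omega (x, y) ->
  partial false h1 x y = partial true h2 x y ->
  frame_X (fun x y => - s x y * h1 x y - c x y * h2 x y) x y
  - frame_Y (fun x y => c x y * h1 x y - s x y * h2 x y) x y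
  = - (c x y * turn true x y - s x y * turn false x y) * (c x y * h1 x y - s x y * h2 x y)
    - (- s x y * turn true x y - c x y * turn false x y)
      * (- s x y * h1 x y - c x y * h2 x y).
Proof.
intros S1 S2 H E.
assert (E1 : forall i, partial i (fun x y => - s x y * h1 x y - c x y * h2 x y) x y =
  - partial i s x y * h1 x y + - s x y * partial i h1 x y
  - (partial i c x y * h2 x y + c x y * partial i h2 x y)) by (intros i; derive_by reflexivity).
assert (E2 : forall i, partial i (fun x y => c x y * h1 x y - s x y * h2 x y) x y =
  partial i c x y * h1 x y + c x y * partial i h1 x y
  - (partial i s x y * h2 x y + s x y * partial i h2 x y)) by (intros i; derive_by reflexivity).
unfold frame_X, frame_Y.
rewrite !E1, !E2, !partial_c, !partial_s, E by assumption. ring.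
Qed.

Lemma field_commutator h x y : smooth h -> Omega (x, y) ->
  frame_X (frame_Y h) x y - frame_Y (frame_X h) x y
  = - (c x y * turn true x y - s x y * turn false x y) * frame_X h x y
    - (- s x y * turn true x y - c x y * turn false x y) * frame_Y h x y.
Proof.
intros Hh H. apply frame_commutator; [solve_smooth|solve_smooth|assumption|].
symmetry; apply partial_comm; assumption.
Qed.

(** The partial derivative of [log |Q| = 2 u + 1/2 log R + const]. *)
Definition log_amplitude (i : bool) (x y : R) : R :=
  2 * partial i u x y - (if i then x else 1 / 2 * y) * (mu x y * mu x y).

(** This and [dbar_im] are the real and imaginary parts of 2 Q_zbar / |Q| = mu, written for c + i s
    = Q / |Q|. *)
Hypothesis dbar_re : forall x y, Omega (x, y) ->
  partial true c x y + c x y * log_amplitude true x y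
  - (partial false s x y + s x y * log_amplitude false x y) = mu x y.
Hypothesis dbar_im : forall x y, Omega (x, y) ->
  partial false c x y + c x y * log_amplitude false x y
  + (partial true s x y + s x y * log_amplitude true x y) = 0.
Hypothesis curvature_eq : forall x y, Omega (x, y) ->
  partial true (partial true u) x y + partial false (partial false u) x y + rho (u x y) * Kfun x y = 0.

(** Once derivatives of [c] and [s] are expressed by [turn], the two equations are a linear system
    with orthogonal matrix; [turn_y] solves it for the other unknown. *)
Lemma turn_x x y : Omega (x, y) ->
  turn true x y = - (mu x y * s x y) - log_amplitude false x y.
Proof.
intros H. pose proof (dbar_re x y H) as H1; pose proof (dbar_im x y H) as H2.
rewrite !partial_c, !partial_s in H1, H2 by assumption.
assert (Hs : s x y ^ 2 = 1 - c x y ^ 2) by (rewrite <- (circle x y H); ring).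
(* The null term is the place where [dbar_im] is substituted. *)
replace (turn true x y) with (turn true x y - c x y * 0) by ring.
rewrite <- H2, <- H1. ring [Hs].
Qed.

Lemma turn_y x y : Omega (x, y) ->
  turn false x y = log_amplitude true x y - mu x y * c x y.
Proof.
intros H. pose proof (dbar_re x y H) as H1; pose proof (dbar_im x y H) as H2.
rewrite !partial_c, !partial_s in H1, H2 by assumption.
assert (Hs : s x y ^ 2 = 1 - c x y ^ 2) by (rewrite <- (circle x y H); ring).
replace (turn false x y) with (turn false x y + s x y * 0) by ring.
rewrite <- H2, <- H1. ring [Hs].
Qed.

Definition v_sol : R -> R -> R := frame_Y u.

Definition solution_env (x y : R) (g : gen) : R :=
  match g with
  | gx => x
  | gy => y
  | gc => c x y
  | gs => s x y
  | gv => v_sol x y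
  | gE => rho (u x y)
  | gm => mu x y
  end.

Lemma solution_env_on_state x y : Omega (x, y) -> on_state (solution_env x y).
Proof.
intros H; pose proof (Omega_R x y H) as HR; repeat split; simpl.
- apply mu_pos; assumption.
- apply exp_pos.
- apply (mu_sq x y HR).
- apply (circle x y H).
Qed.

Lemma smooth_solution_env g : smooth (fun x y => solution_env x y g).
Proof.
destruct g; simpl; unfold v_sol, frame_Y, rho; solve_smooth.
Qed.

Lemma partial_mu i x y : Omega (x, y) -> partial i mu x y = (if i then x else y / 2) * mu x y ^ 3.
Proof. intros H; apply partial_unique, is_partial_mu, Omega_R, H. Qed.

(** Inserting [turn_x] and [turn_y] into [turn_closed] produces twice the Laplacian of [u], which
    [curvature_eq] removes. The derivatives of [mu * s] and [mu * c] contribute mu times the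
    Y-derivative of the angle, for which the relation is solved. *)
Lemma turn_Y x y : Omega (x, y) ->
  - s x y * turn true x y - c x y * turn false x y = - eval (solution_env x y) a_.
Proof.
intros H.
pose proof (turn_closed x y H) as E.
rewrite (partial_ext false _ (fun x y => - (mu x y * s x y) -
  (2 * partial false u x y - 1 / 2 * y * (mu x y * mu x y))) x y H turn_x) in E.
rewrite (partial_ext true _ (fun x y =>
  (2 * partial true u x y - x * (mu x y * mu x y)) - mu x y * c x y) x y H turn_y) in E.
assert (E1 : partial false (fun x y => - (mu x y * s x y) -
  (2 * partial false u x y - 1 / 2 * y * (mu x y * mu x y))) x y =
  - (partial false mu x y * s x y + mu x y * partial false s x y)
  - (2 * partial false (partial false u) x y - 1 / 2 * (mu x y * mu x y)
     - y * (mu x y * partial false mu x y)))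
  by (derive_by field).
assert (E2 : partial true (fun x y =>
  (2 * partial true u x y - x * (mu x y * mu x y)) - mu x y * c x y) x y =
  2 * partial true (partial true u) x y - mu x y * mu x y - 2 * x * (mu x y * partial true mu x y)
  - (partial true mu x y * c x y + mu x y * partial true c x y)) by (derive_by ring).
rewrite E1, E2, !partial_mu, partial_c, partial_s in E by assumption.
pose proof (curvature_eq x y H) as HK.
destruct (solution_env_on_state x y H) as [Hm [_ [Hr _]]].
unfold Kfun in HK. simpl in Hm, Hr |- *.
set (m := mu x y) in *.
set (T := - s x y * turn true x y - c x y * turn false x y).
assert (E3 : m * T = m * s x y * y * m ^ 2 / 2 - m * x * c x y * m ^ 2 - 3 / 2 * m ^ 2
  - (2 * x ^ 2 + 1 / 2 * y ^ 2) * m ^ 4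
  - 2 * rho (u x y) * (2 * x ^ 2 + 1 / 2 * y ^ 2 - 1 / 8)) by (unfold T; nra).
apply (Rmult_eq_reg_l m); [|lra]. rewrite E3.
(* The term in K rho carries 1 / m, encoded in [a_] as m R / 2; m^2 R = 2 times K rho reconciles the
   two forms. *)
pose proof (f_equal (Rmult ((2 * x ^ 2 + 1 / 2 * y ^ 2 - 1 / 8) * rho (u x y))) Hr) as E4.
lra.
Qed.

Lemma turn_X x y : Omega (x, y) ->
  c x y * turn true x y - s x y * turn false x y = eval (solution_env x y) B_.
Proof.
intros H. rewrite turn_x, turn_y by assumption.
unfold log_amplitude; simpl; unfold v_sol, frame_Y.
assert (Hs : s x y ^ 2 = 1 - c x y ^ 2) by (rewrite <- (circle x y H); ring).
field [Hs].
Qed.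

(** [turn_x] and [turn_y] give Y theta = mu - 2 X u + d / R; with Y theta = - a this determines X
    u. *)
Lemma frame_X_u x y : Omega (x, y) -> frame_X u x y = eval (solution_env x y) P_.
Proof.
intros H.
pose proof (turn_x x y H) as Ex; pose proof (turn_y x y H) as Ey.
pose proof (turn_Y x y H) as ET.
unfold P_; cbn [eval]. apply Ropp_eq_compat in ET. rewrite Ropp_involutive in ET.
rewrite <- ET. unfold frame_X; simpl; rewrite Ex, Ey; unfold log_amplitude.
assert (Hs : s x y ^ 2 = 1 - c x y ^ 2) by (rewrite <- (circle x y H); ring).
field [Hs].
Qed.

(** The counterpart of [derivation_eval] along a solution, with only [x] and [y] as independent
    variables. *)
Lemma field_eval (F : pexp) (delta : gen -> pexp) x y (k1 k2 : R) :
  Omega (x, y) ->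
  (forall g, k1 * partial true (fun x y => solution_env x y g) x y
     + k2 * partial false (fun x y => solution_env x y g) x y
     = eval (solution_env x y) (delta g)) ->
  k1 * partial true (fun x y => eval (solution_env x y) F) x y
  + k2 * partial false (fun x y => eval (solution_env x y) F) x y
  = eval (solution_env x y) (der delta F).
Proof.
intros H Hg.
assert (HD : forall i, partial i (fun x y => eval (solution_env x y) F) x y =
  tangent (solution_env x y) (fun g => partial i (fun x y => solution_env x y g) x y) F).
{ intros i; apply partial_unique, is_partial_eval.
  intros g; apply smooth_is_partial; [apply smooth_solution_env|exact H]. }
rewrite !HD, eval_der, <- !tangent_scale, <- tangent_add.
apply tangent_ext, Hg.
Qed.

(** The [gv] component is kept as the actual number X v, wrapped in [Const], because it is
    identified with [f_] only later. *)
Lemma frame_X_env g x y : Omega (x, y) ->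
  frame_X (fun x y => solution_env x y g) x y =
  eval (solution_env x y) (X_images (Const (frame_X v_sol x y)) g).
Proof.
intros H.
pose proof (turn_X x y H) as HB; pose proof (frame_X_u x y H) as HP; unfold frame_X in HP.
unfold frame_X; destruct g; cbn [X_images eval solution_env x_ y_ c_ s_ v_ E_ m_];
  rewrite <- ?HB, <- ?HP.
- rewrite (partial_unique _ _ _ _ _ (is_partial_fst true x y)),
    (partial_unique _ _ _ _ _ (is_partial_fst false x y)); ring.
- rewrite (partial_unique _ _ _ _ _ (is_partial_snd true x y)),
    (partial_unique _ _ _ _ _ (is_partial_snd false x y)); ring.
- change (fun x y => c x y) with c; rewrite !partial_c by assumption; ring.
- change (fun x y => s x y) with s; rewrite !partial_s by assumption; ring.
- reflexivity.
- assert (HE : forall i, partial i (fun x y => rho (u x y)) x y = 2 * rho (u x y) * partial i u x y).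
  { intros i; unfold rho; eapply partial_unique, is_partial_eq.
    - apply is_partial_comp; [apply is_derive_exp|derive_partial].
    - ring. }
  rewrite !HE; ring.
- change (fun x y => mu x y) with mu; rewrite !partial_mu by assumption; field.
Qed.

Lemma frame_Y_env g x y : Omega (x, y) ->
  frame_Y (fun x y => solution_env x y g) x y =
  eval (solution_env x y) (Y_images (Const (frame_Y v_sol x y)) g).
Proof.
intros H.
pose proof (turn_Y x y H) as HB.
assert (Ha : eval (solution_env x y) a_ = - (- s x y * turn true x y - c x y * turn false x y)) by lra.
unfold frame_Y; destruct g; cbn [Y_images eval solution_env x_ y_ c_ s_ v_ E_ m_];
  rewrite ?Ha.
- rewrite (partial_unique _ _ _ _ _ (is_partial_fst true x y)),
    (partial_unique _ _ _ _ _ (is_partial_fst false x y)); ring.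
- rewrite (partial_unique _ _ _ _ _ (is_partial_snd true x y)),
    (partial_unique _ _ _ _ _ (is_partial_snd false x y)); ring.
- change (fun x y => c x y) with c; rewrite !partial_c by assumption; ring.
- change (fun x y => s x y) with s; rewrite !partial_s by assumption; ring.
- reflexivity.
- assert (HE : forall i, partial i (fun x y => rho (u x y)) x y = 2 * rho (u x y) * partial i u x y).
  { intros i; unfold rho; eapply partial_unique, is_partial_eq.
    - apply is_partial_comp; [apply is_derive_exp|derive_partial].
    - ring. }
  rewrite !HE; unfold v_sol, frame_Y; ring.
- change (fun x y => mu x y) with mu; rewrite !partial_mu by assumption; field.
Qed.

Lemma frame_X_eval F w x y : Omega (x, y) -> frame_X v_sol x y = eval (solution_env x y) w ->
  frame_X (fun x y => eval (solution_env x y) F) x y = eval (solution_env x y) (der (X_images w) F).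
Proof.
intros H Hw. unfold frame_X.
rewrite <- (field_eval F (X_images w) x y (c x y) (- s x y) H); [ring|].
intros g.
transitivity (eval (solution_env x y) (X_images (Const (frame_X v_sol x y)) g)).
- rewrite <- (frame_X_env g x y H); unfold frame_X; ring.
- destruct g; try reflexivity. exact Hw.
Qed.

Lemma frame_Y_eval F w x y : Omega (x, y) -> frame_Y v_sol x y = eval (solution_env x y) w ->
  frame_Y (fun x y => eval (solution_env x y) F) x y = eval (solution_env x y) (der (Y_images w) F).
Proof.
intros H Hw. unfold frame_Y.
rewrite <- (field_eval F (Y_images w) x y (- s x y) (- c x y) H); [ring|].
intros g.
transitivity (eval (solution_env x y) (Y_images (Const (frame_Y v_sol x y)) g)).
- rewrite <- (frame_Y_env g x y H); unfold frame_Y; ring.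
- destruct g; try reflexivity. exact Hw.
Qed.

(** * Integrability conditions from the commutator *)

Lemma frame_X_ext f g x y : Omega (x, y) ->
  (forall a b, Omega (a, b) -> f a b = g a b) -> frame_X f x y = frame_X g x y.
Proof. intros H Hfg; unfold frame_X; rewrite !(fun i => partial_ext i f g x y H Hfg); reflexivity. Qed.

Lemma frame_Y_ext f g x y : Omega (x, y) ->
  (forall a b, Omega (a, b) -> f a b = g a b) -> frame_Y f x y = frame_Y g x y.
Proof. intros H Hfg; unfold frame_Y; rewrite !(fun i => partial_ext i f g x y H Hfg); reflexivity. Qed.

(** The commutator applied to [u] reads X v - Y P = - B P + a v. *)
Lemma frame_X_v x y : Omega (x, y) -> frame_X v_sol x y = eval (solution_env x y) f_.
Proof.
intros H.
pose proof (field_commutator u x y smooth_u H) as E.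
rewrite turn_X, turn_Y, frame_X_u in E by assumption.
rewrite (frame_Y_ext (frame_X u) _ x y H frame_X_u) in E.
rewrite (frame_Y_eval P_ (Const (frame_Y v_sol x y)) x y H eq_refl) in E.
(* [P_] does not contain [gv], so the component along [v] is immaterial. *)
replace (eval (solution_env x y) (der (Y_images (Const (frame_Y v_sol x y))) P_))
  with (eval (solution_env x y) (der (Y_images (Const 0)) P_)) in E
  by (rewrite !eval_der; reflexivity).
fold v_sol in E. unfold f_. cbn [eval]. change (eval (solution_env x y) v_) with (v_sol x y). lra.
Qed.

(** The commutator on the differential of the angle reads - X a - Y B = - B^2 - a^2, and Y B = 2 Y v
    + Y (e / R). *)
Lemma frame_Y_v x y : Omega (x, y) -> frame_Y v_sol x y = eval (solution_env x y) g_.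
Proof.
intros H.
pose proof (frame_commutator (turn true) (turn false) x y (smooth_turn true) (smooth_turn false) H
  (turn_closed x y H)) as E.
rewrite turn_X, turn_Y in E by assumption.
rewrite (frame_X_ext _ (fun x y => eval (solution_env x y) (Const (-1) * a_)%P) x y H) in E
  by (intros a b Hab; rewrite turn_Y by exact Hab; simpl; ring).
rewrite (frame_Y_ext _ (fun x y => eval (solution_env x y) B_) x y H turn_X) in E.
rewrite (frame_X_eval _ (Const (frame_X v_sol x y)) x y H eq_refl) in E.
rewrite (frame_Y_eval _ (Const (frame_Y v_sol x y)) x y H eq_refl) in E.
unfold g_. cbn [eval].
replace (eval (solution_env x y) (der (X_images (Const 0)) a_))
  with (eval (solution_env x y) (der (X_images (Const (frame_X v_sol x y))) a_))
  by (rewrite !eval_der; reflexivity).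
replace (eval (solution_env x y) (der (Y_images (Const 0)) eR_))
  with (eval (solution_env x y) (der (Y_images (Const (frame_Y v_sol x y))) eR_))
  by (rewrite !eval_der; reflexivity).
unfold B_ at 1 in E; cbn [der eval v_ Y_images] in E.
lra.
Qed.

(** The commutator applied to [v] reads X g - Y f = - B f + a g. *)
Lemma curvature_zero x y : Omega (x, y) -> eval (solution_env x y) curvature_ = 0.
Proof.
intros H.
assert (smooth_v : smooth v_sol) by exact (smooth_solution_env gv).
pose proof (field_commutator v_sol x y smooth_v H) as E.
rewrite turn_X, turn_Y in E by assumption.
rewrite (frame_X_ext _ _ x y H frame_Y_v), (frame_Y_ext _ _ x y H frame_X_v) in E.
rewrite (frame_X_eval _ f_ x y H (frame_X_v x y H)) in E.
rewrite (frame_Y_eval _ g_ x y H (frame_Y_v x y H)) in E.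
rewrite frame_X_v, frame_Y_v in E by assumption.
unfold curvature_; cbn [eval]. lra.
Qed.

Lemma no_frame_solution x y : ~ Omega (x, y).
Proof.
intros H. pose proof (curvature_neg _ (solution_env_on_state x y H)) as Hn.
rewrite curvature_zero in Hn by exact H. lra.
Qed.

End OpenSet.

(** [Q / |Q| = 2 mu exp (- 2 u) Q], since [|Q|^2 = rho^2 R / 8 = (rho / (2 mu))^2]. *)
Lemma partial_normalized (Omega : R * R -> Prop) (u q : R -> R -> R) i x y :
  open Omega -> (forall x y, Omega (x, y) -> 0 < Rfun x y) ->
  smooth_on Omega u -> smooth_on Omega q -> Omega (x, y) ->
  let h := fun x y => 2 * mu x y * exp (-2 * u x y) * q x y in
  partial i h x y + h x y * log_amplitude u i x y = 2 * mu x y * exp (-2 * u x y) * partial i q x y.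
Proof.
intros Ho HR Hu Hq H h.
assert (E : partial i h x y = (2 * ((if i then x else y / 2) * mu x y ^ 3) * exp (-2 * u x y)
  + 2 * mu x y * (-2 * partial i u x y * exp (-2 * u x y))) * q x y
  + 2 * mu x y * exp (-2 * u x y) * partial i q x y).
{ apply partial_unique. eapply is_partial_eq.
  - apply is_partial_mult; [|apply (smooth_is_partial Omega); assumption].
    apply is_partial_mult.
    + apply is_partial_mult; [apply is_partial_const|apply is_partial_mu, HR, H].
    + apply is_partial_comp; [apply is_derive_exp|].
      apply is_partial_mult; [apply is_partial_const|apply (smooth_is_partial Omega); assumption].
  - cbv beta. ring. }
rewrite E; unfold h, log_amplitude. destruct i; field.
Qed.

Theorem theorem9p3 :
  (forall x y u t v : R,
     state_space x y u t v -> frobenius_curvature x y u t v < 0) /\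
  ~ (exists (Omega : R * R -> Prop) (u : R -> R -> R) (Q : R -> R -> C),
       open Omega /\
       (exists p : R * R, Omega p) /\
       (forall x y : R, Omega (x, y) -> 0 < Rfun x y) /\
       smooth_on Omega u /\
       Csmooth_on Omega Q /\
       compatibility_system Omega u Q).
Proof.
split; [intros x y u t v H; apply frobenius_curvature_neg, H|].
intros (Omega & u & Q & Ho & [[x0 y0] H0] & HR & Hu & [H1 H2] & HS).
set (q1 x y := Re (Q x y)); set (q2 x y := Im (Q x y)).
assert (S1 : smooth_on Omega q1) by exact H1.
assert (S2 : smooth_on Omega q2) by exact H2.
assert (Su : smooth_on Omega u) by exact Hu.
set (nrm (q : R -> R -> R) x y := 2 * mu x y * exp (-2 * u x y) * q x y).
assert (Sn : forall q, smooth_on Omega q -> smooth_on Omega (nrm q)).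
{ intros q Hq. unfold nrm.
  repeat first [assumption | apply smooth_exp | apply smooth_mult | apply smooth_const | apply smooth_mu]. }
assert (HE : forall x y, exp (-2 * u x y) * rho (u x y) = 1).
{ intros x y; unfold rho; rewrite <- exp_plus, <- exp_0; f_equal; ring. }
(* These are the real and imaginary parts of 2 Q_zbar = rho / 2. *)
assert (Hd : forall x y, Omega (x, y) ->
  partial true q1 x y - partial false q2 x y = 1 / 2 * rho (u x y) /\
  partial true q2 x y + partial false q1 x y = 0).
{ intros x y H. destruct (HS x y H) as [_ [Hb _]].
  pose proof (f_equal fst Hb) as B1; pose proof (f_equal snd Hb) as B2.
  simpl in B1, B2.
  change (partial_derive 1 0 (fun x y => Re (Q x y)) x y) with (partial true q1 x y) in *.
  change (partial_derive 1 0 (fun x y => Im (Q x y)) x y) with (partial true q2 x y) in *.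
  change (partial_derive 0 1 (fun x y => Re (Q x y)) x y) with (partial false q1 x y) in *.
  change (partial_derive 0 1 (fun x y => Im (Q x y)) x y) with (partial false q2 x y) in *.
  fold (rho (u x y)) in B1.
  split; lra. }
(* The frame is Q / |Q|; the unit circle relation, the two parts of the [dbar] equation and the
   equation for [u] are then checked in this order. *)
apply (no_frame_solution Omega Ho HR (nrm q1) (nrm q2) u (Sn _ S1) (Sn _ S2) Su)
  with (x := x0) (y := y0).
- intros x y H. destruct (HS x y H) as [_ [_ HC]].
  unfold Cmod in HC.
  rewrite pow2_sqrt in HC by (apply Rplus_le_le_0_compat; apply pow2_ge_0).
  change (q1 x y ^ 2 + q2 x y ^ 2 = 1 / 8 * exp (4 * u x y) * Rfun x y) in HC.
  unfold nrm.
  replace (_ + _) with (4 * mu x y ^ 2 * exp (-2 * u x y) ^ 2 * (q1 x y ^ 2 + q2 x y ^ 2)) by ring.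
  rewrite HC. replace (exp (4 * u x y)) with (rho (u x y) ^ 2)
    by (unfold rho; simpl; rewrite Rmult_1_r, <- exp_plus; f_equal; ring).
  replace (_ * _) with (1 / 2 * (exp (-2 * u x y) * rho (u x y)) ^ 2 * (mu x y ^ 2 * Rfun x y)) by field.
  rewrite HE, (mu_sq x y (HR x y H)). field.
- intros x y H. unfold nrm; rewrite !(partial_normalized Omega) by assumption.
  destruct (Hd x y H) as [E _].
  replace (_ - _) with (2 * mu x y * exp (-2 * u x y) * (partial true q1 x y - partial false q2 x y))
    by ring.
  rewrite E. replace (_ * _) with (mu x y * (exp (-2 * u x y) * rho (u x y))) by field.
  rewrite HE; ring.
- intros x y H. unfold nrm; rewrite !(partial_normalized Omega) by assumption.
  destruct (Hd x y H) as [_ E].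
  replace (_ + _) with (2 * mu x y * exp (-2 * u x y) * (partial true q2 x y + partial false q1 x y))
    by ring.
  rewrite E; ring.
- intros x y H. destruct (HS x y H) as [HL _]. exact HL.
- exact H0.
Qed.
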